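(* Let $b>0$. Suppose that $|\langle\theta^\star,X_t\rangle|\le b$ for all $t\ge1$ and that $\psi$ is $m$-strongly convex on $[-b,b]$ with $m>0$. Let $(\theta_t)_{t\ge1}$ be a sequence of random parameters in $\mathbb{R}^d$ such that each $\theta_t$ is $\mathcal{F}_{t-1}$-measurable, and let $\widehat Y_t=[\langle\theta_t,X_t\rangle]_b$. Let $\delta\in(0,1)$ and, for $n\ge1$, define $$\beta_n=\frac2m\,\mathrm{regret}_{\theta^n}(\theta^\star)+\frac4m\log\frac1\delta,\qquad \Theta_n=\Big\{\theta\in\mathbb{R}^d:\ \frac12\sum_{t=1}^n\big(\langle\theta,X_t\rangle-\widehat Y_t\big)^2\le\beta_n\Big\}.$$ Then $\mathbb{P}[\exists n\ge1:\ \theta^\star\notin\Theta_n]\le\delta$.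
   Context: Generalized linear model (GLM). Fix $d\ge1$. Labels take values in a measurable set $\mathcal{Y}\subseteq\mathbb{R}$ equipped with a fixed $\sigma$-finite reference measure $\mathrm{d}y$ (e.g. Lebesgue or counting measure); all densities on $\mathcal{Y}$ are with respect to it. Let $h:\mathcal{Y}\to[0,\infty)$ and let $\psi:\mathbb{R}\to\mathbb{R}$ be convex and differentiable, such that for all $x,\theta\in\mathbb{R}^d$ the function $p(y|x,\theta)=\exp(\langle\theta,x\rangle y-\psi(\langle\theta,x\rangle))h(y)$ is a probability density on $\mathcal{Y}$. The data are random pairs $(X_t,Y_t)_{t\ge1}$ with $X_t\in\mathbb{R}^d$, $Y_t\in\mathcal{Y}$; let $\mathcal{F}_t=\sigma(X_1,Y_1,\dots,X_t,Y_t,X_{t+1})$ and $\mathcal{F}_0=\sigma(X_1)$. Covariates may be chosen adaptively. For a fixed unknown $\theta^\star\in\mathbb{R}^d$ and every $t\ge 1$, the conditional density of $Y_t$ given $\mathcal{F}_{t-1}$ is $p(\cdot|X_t,\theta^\star)$. Standing assumption: $\psi$ is $M$-smooth for some $M>0$, i.e. twice differentiable with $\psi''(z)\le M$ for all $z\in\mathbb{R}$. $\psi$ is $m$-strongly convex on $[-b,b]$ if $\psi''(z)\ge m$ for all $z\in[-b,b]$. Loss: $\ell_t(\theta)=-\langle\theta,X_t\rangle Y_t+\psi(\langle\theta,X_t\rangle)-\log h(Y_t)=-\log p(Y_t|X_t,\theta)$. For $\theta^n=(\theta_1,\dots,\theta_n)$, $\mathrm{regret}_{\theta^n}(\bar\theta)=\sum_{t=1}^n(\ell_t(\theta_t)-\ell_t(\bar\theta))$.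 Truncation: $[z]_b=\max\{\min\{z,b\},-b\}$. *)

(* Defs.v *)
From HB Require Import structures.
From mathcomp Require Import all_boot all_order all_algebra.
From mathcomp Require Import all_classical all_reals all_analysis measurable_realfun.
Import Order.TTheory GRing.Theory Num.Theory.
Import numFieldNormedType.Exports.

Set Implicit Arguments.
Unset Strict Implicit.
Unset Printing Implicit Defensive.

Local Open Scope classical_set_scope.
Local Open Scope ring_scope.

(* R^d is [d.-tuple R]: its measurable structure in the library is the product
   sigma-algebra, i.e. the Borel sigma-algebra of R^d. *)
Definition inner (R : realType) (d : nat) (u v : d.-tuple R) : R :=
  \sum_(i < d) tnth u i * tnth v i.

Definition trunc (R : realType) (b z : R) : R := Num.max (Num.min z b) (- b).

Definition smooth (R : realType) (M : R) (psi : R -> R) : Prop :=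
  [/\ forall z, derivable psi z 1,
      forall z, derivable (derive1 psi) z 1 &
      forall z, derive1n 2 psi z <= M].

Definition strongly_convex_on (R : realType) (m b : R) (psi : R -> R) : Prop :=
  forall z, z \in `[- b, b] -> m <= derive1n 2 psi z.

(* The label space is a measurable set [L] of reals; a measure on [L] is given
   as a measure [mu] on R of which only the restriction to [L] is ever used.
   Likewise for functions on [L]. *)
Definition is_density (R : realType) (mu : {measure set R -> \bar R})
    (L : set R) (f : R -> R) : Prop :=
  [/\ measurable_fun L f,
      forall y, L y -> 0 <= f y &
      (\int[mu]_(y in L) (f y)%:E = 1)%E].

Definition glm_density (R : realType) (d : nat) (psi h : R -> R)
    (x theta : d.-tuple R) (y : R) : R :=
  expR (inner theta x * y - psi (inner theta x)) * h y.

(* F_t, generated by X_1, ..., X_{t+1} and Y_1, ..., Y_t; the values of [X] and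
   [Y] at index 0 play no role. *)
Definition history (disp : measure_display) (T : measurableType disp)
    (R : realType) (d : nat) (X : nat -> T -> d.-tuple R) (Y : nat -> T -> R)
    (t : nat) : set_system T :=
  <<s (\bigcup_(s in [set s | (1 <= s <= t.+1)%N])
         g_sigma_algebra_preimage (X s))
      `|`
      (\bigcup_(s in [set s | (1 <= s <= t)%N])
         g_sigma_algebra_preimage (Y s)) >>.

(* [f] is measurable with respect to the sub-sigma-algebra [G]. *)
Definition measurable_wrt (disp disp' : measure_display)
    (T : measurableType disp) (U : measurableType disp')
    (G : set_system T) (f : T -> U) : Prop :=
  g_sigma_algebra_preimage f `<=` G.

(* The random density [f w] is a conditional density of [Z] given [G]: for every
   measurable [B] included in [L], the random variable \int_B f w y dy is a
   version of the conditional probability of [Z \in B] given [G]. *)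
Definition is_cond_density (disp : measure_display) (T : measurableType disp)
    (R : realType) (P : probability T R) (mu : {measure set R -> \bar R})
    (L : set R) (G : set_system T) (Z : T -> R) (f : T -> R -> R) : Prop :=
  forall B : set R, measurable B -> B `<=` L ->
    measurable_wrt G (fun w => \int[mu]_(y in B) (f w y)%:E)%E /\
    forall A : set T, G A ->
      P (A `&` Z @^-1` B) =
      (\int[P]_(w in A) \int[mu]_(y in B) (f w y)%:E)%E.

(* Since [ln 0 = 0], the terms in [h] cancel in [regret] even where [h] is 0;
   this happens for the observed labels with probability 0 only. *)
Definition loss (R : realType) (d : nat) (psi h : R -> R)
    (x : d.-tuple R) (y : R) (theta : d.-tuple R) : R :=
  - (inner theta x * y) + psi (inner theta x) - ln (h y).

Definition regret (T : Type) (R : realType) (d : nat) (psi h : R -> R)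
    (X : nat -> T -> d.-tuple R) (Y : nat -> T -> R)
    (theta : nat -> T -> d.-tuple R) (n : nat) (thetabar : d.-tuple R)
    (w : T) : R :=
  \sum_(1 <= t < n.+1) (loss psi h (X t w) (Y t w) (theta t w)
                        - loss psi h (X t w) (Y t w) thetabar).

Definition beta (T : Type) (R : realType) (d : nat) (psi h : R -> R)
    (X : nat -> T -> d.-tuple R) (Y : nat -> T -> R)
    (theta : nat -> T -> d.-tuple R) (thetastar : d.-tuple R)
    (m delta : R) (n : nat) (w : T) : R :=
  2 / m * regret psi h X Y theta n thetastar w + 4 / m * ln (1 / delta).

Definition Yhat (T : Type) (R : realType) (d : nat)
    (X : nat -> T -> d.-tuple R) (theta : nat -> T -> d.-tuple R)
    (b : R) (t : nat) (w : T) : R :=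
  trunc b (inner (theta t w) (X t w)).

Definition confidence_set (T : Type) (R : realType) (d : nat)
    (psi h : R -> R) (X : nat -> T -> d.-tuple R) (Y : nat -> T -> R)
    (theta : nat -> T -> d.-tuple R) (thetastar : d.-tuple R)
    (b m delta : R) (n : nat) (w : T) : set (d.-tuple R) :=
  [set th | 1 / 2 * \sum_(1 <= t < n.+1)
                      (inner th (X t w) - Yhat X theta b t w) ^+ 2
            <= beta psi h X Y theta thetastar m delta n w].

(* Main.v *)
(* Write z0 = <thetastar, X_t> and z = <theta_t, X_t>. Given F_{t-1}, the square
   root of the likelihood ratio of theta_t to thetastar at Y_t has expectation
   exp (- g), where g = (psi z + psi z0) / 2 - psi ((z + z0) / 2) is the midpoint
   convexity gap of psi. Truncating z to [-b, b] can only decrease the gap, and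
   strong convexity on [-b, b] then gives g >= m / 8 * (z0 - Yhat_t) ^ 2. Hence
   the products of exp (m / 8 * (z0 - Yhat_t) ^ 2 - r_t / 2), with r_t the t-th
   regret increment, form a supermartingale, and Ville's inequality at level
   1 / delta is the claim. *)

Require Import Defs.
From HB Require Import structures.
From mathcomp Require Import all_boot all_order all_algebra.
From mathcomp Require Import all_classical all_reals all_analysis measurable_realfun.
From mathcomp Require Import ring lra.
Import Order.TTheory GRing.Theory Num.Theory.
Import numFieldNormedType.Exports.

Set Implicit Arguments.
Unset Strict Implicit.
Unset Printing Implicit Defensive.

Local Open Scope classical_set_scope.
Local Open Scope ring_scope.

(** * Integration against densities and conditional densities *)

Section density.
Local Open Scope ereal_scope.

(* The proof arguments let the measure structure be inferred from the term. *)
Definition mdensity d (T : measurableType d) (R : realType)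
    (mu : {measure set T -> \bar R}) (f : T -> R)
    (f0 : forall x, (0 <= f x)%R) (mf : measurable_fun setT f) (A : set T) :=
  \int[mu]_(x in A) (f x)%:E.

Section mdensity_measure.
Context d (T : measurableType d) (R : realType)
  (mu : {measure set T -> \bar R}) (f : T -> R)
  (f0 : forall x, (0 <= f x)%R) (mf : measurable_fun setT f).

Let mdensity0 : mdensity mu f0 mf set0 = 0.
Proof. exact: integral_set0. Qed.

Let mdensity_ge0 A : 0 <= mdensity mu f0 mf A.
Proof. by apply: integral_ge0 => x _; rewrite lee_fin. Qed.

Let mdensity_sigma_additive : semi_sigma_additive (mdensity mu f0 mf).
Proof.
move=> F mF tF mUF; rewrite /mdensity; apply: cvg_toP.
  apply: ereal_nondecreasing_is_cvgn => m n mn.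
  apply: lee_sum_nneg_natr => // k _ _; apply: integral_ge0 => x _.
  by rewrite lee_fin.
rewrite ge0_integral_bigcup//=.
- exact/measurable_funTS/measurable_EFinP.
- by move=> x _; rewrite lee_fin.
Qed.

HB.instance Definition _ := isMeasure.Build _ _ _ (mdensity mu f0 mf)
  mdensity0 mdensity_ge0 mdensity_sigma_additive.

End mdensity_measure.

Import HBNNSimple.

(** Monotone convergence along simple functions increasing to [g] reduces the claim to indicators,
    where it is the hypothesis on [nu]. *)
Lemma ge0_integral_density d (T : measurableType d) (R : realType)
    (mu nu : {measure set T -> \bar R}) (f : T -> R) (g : T -> \bar R) :
    (forall x, (0 <= f x)%R) -> measurable_fun setT f ->
    (forall A, measurable A -> nu A = \int[mu]_(x in A) (f x)%:E) ->
    (forall x, 0 <= g x) -> measurable_fun setT g ->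
  \int[nu]_x g x = \int[mu]_x (g x * (f x)%:E).
Proof.
move=> f0 mf nuE g0 mg.
pose h := nnsfun_approx measurableT mg.
have hE x : EFin \o h ^~ x @ \oo --> g x by exact: cvg_nnsfun_approx.
have nd_h x : {homo (fun n => h n x) : m n / (m <= n)%N >-> (m <= n)%R}.
  by move=> m n mn; exact/lefP/nd_nnsfun_approx.
transitivity (limn (fun n => \int[nu]_x (EFin \o h n) x)).
  rewrite -monotone_convergence//.
  - by apply: eq_integral => x _; apply/esym/cvg_lim => //; exact: hE.
  - by move=> n; exact/measurable_EFinP.
  - by move=> n x _; rewrite lee_fin.
  - by move=> x _ m n mn; rewrite lee_fin nd_h.
transitivity (limn (fun n => \int[mu]_x ((h n x)%:E * (f x)%:E))); last first.
  rewrite -monotone_convergence//.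
  - apply: eq_integral => x _; apply/cvg_lim => //.
    by apply: cvgeZr => //; exact: hE.
  - move=> n; apply: emeasurable_funM; exact/measurable_EFinP.
  - by move=> n x _; rewrite mule_ge0// lee_fin.
  - by move=> x _ m n mn; rewrite lee_wpmul2r// ?lee_fin ?nd_h.
congr (limn _); apply/funext => n.
have mh y : measurable (h n @^-1` [set y]) by exact: measurable_funPTI.
(* For the simple function [h n], both integrals are the finite sum, over its values, of the value
   times the [nu]-mass of its level set. *)
transitivity (\sum_(y \in range (h n)) y%:E * nu (h n @^-1` [set y])).
  by rewrite integralT_nnsfun sintegralE.
under [RHS]eq_integral => x _.
  rewrite fimfunE -fsumEFin// ge0_mule_fsuml; last first.
    by move=> y; exact: nnfun_muleindic_ge0.
  over.
rewrite ge0_integral_fsum//; last 2 first.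
- move=> y; apply: emeasurable_funM; apply/measurable_EFinP => //.
  exact: measurable_funM.
- by move=> y x _; apply: mule_ge0; [exact: nnfun_muleindic_ge0|rewrite lee_fin].
apply: eq_fsbigr => y /[!inE] -[t _ ty].
under [RHS]eq_integral do rewrite EFinM -muleA.
rewrite ge0_integralZl//.
- by rewrite nuE// [in LHS]integral_mkcond epatch_indic;
    congr (_ * _); apply: eq_integral => x _; rewrite muleC.
- apply: emeasurable_funM; exact/measurable_EFinP.
- by move=> x _; rewrite mule_ge0 ?lee_fin.
- by rewrite -ty lee_fin.
Qed.
End density.

(** The hypothesis says that the joint law of [(Q, Z)] and the measure with density [f] against (law
    of [Q]) x [mu] agree on rectangles. These form a generating pi-system, so the two measures
    coincide, and Tonelli splits the integral of [g]. *)
Lemma ge0_integral_cond_density d dE dF (T : measurableType d)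
    (E : measurableType dE) (F : measurableType dF) (R : realType)
    (P : probability T R) (mu : {sigma_finite_measure set F -> \bar R})
    (Q : {mfun T >-> E}) (Z : {mfun T >-> F}) (f : E * F -> R) :
    (forall x, 0 <= f x) -> measurable_fun setT f ->
    (forall A B, measurable A -> measurable B ->
      P (Q @^-1` A `&` Z @^-1` B) =
      \int[P]_(w in Q @^-1` A) \int[mu]_(y in B) (f (Q w, y))%:E)%E ->
    forall g : E * F -> \bar R,
      (forall x, 0 <= g x)%E -> measurable_fun setT g ->
  (\int[P]_w g (Q w, Z w) =
   \int[P]_w \int[mu]_y (g (Q w, y) * (f (Q w, y))%:E))%E.
Proof.
move=> f0 mf PE g g0 mg.
have mQZ : measurable_fun setT (fun w => (Q w, Z w)).
  exact: measurable_fun_pair.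
pose QZ : {mfun T >-> (E * F)%type} :=
  HB.pack (fun w => (Q w, Z w)) (isMeasurableFun.Build _ _ _ _ _ mQZ).
pose lam : probability E R := distribution P Q.
have mf' : measurable_fun setT (EFin \o f) by exact/measurable_EFinP.
have nuE C : measurable C ->
    distribution P QZ C = (\int[(lam \x mu)%E]_(x in C) (f x)%:E)%E.
  move=> mC; rewrite -[RHS]/(mdensity (lam \x mu)%E f0 mf C).
  pose G : set (set (E * F)) :=
    [set A `*` B | A in measurable & B in measurable].
  apply: (measure_unique G (fun=> setT)) => //.
  - by rewrite measurable_prod_measurableType.
  - move=> _ _ [A mA [B mB <-]] [A' mA' [B' mB' <-]]; rewrite -setXI.
    exists (A `&` A'); first exact: measurableI.
    by exists (B `&` B') => //; exact: measurableI.
  - by move=> _; exists setT => //; exists setT => //; rewrite setXTT.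
  - by apply/seteqP; split=> // x _; exists 0%N.
  - move=> _ [A mA [B mB <-]].
    rewrite /= /mdensity /distribution /pushforward /=.
    rewrite [LHS](_ : _ = P (Q @^-1` A `&` Z @^-1` B)) ?PE//.
    rewrite [RHS]integral_mkcond; set phi := _ \_ _.
    have mphi : measurable_fun setT phi.
      apply/(measurable_restrictT _ _).1; first exact: measurableX.
      exact: measurable_funTS.
    have phi0 x : (0 <= phi x)%E.
      by apply: erestrict_ge0 => y _; rewrite lee_fin.
    rewrite fubini_tonelli1// ge0_integral_distribution; last 2 first.
    + exact: measurable_fun_fubini_tonelli_F.
    + by move=> x; exact: integral_ge0.
    rewrite [LHS]integral_mkcond.
    apply: eq_integral => w _ /=.
    rewrite /fubini_F /phi [LHS]patchE; case: ifPn => [|/negP] wA.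
      rewrite [LHS]integral_mkcond; apply: eq_integral => y _.
      by rewrite !patchE in_setX/= (_ : (Q w \in A) = true)//; apply/mem_set/set_mem.
    rewrite integral0_eq// => y _; rewrite patchE in_setX/= ifF//.
    by apply/negP => /andP[/set_mem QA _]; exact/wA/mem_set.
  - by move=> _; rewrite [ltLHS](_ : _ = 1%E) ?ltry//; exact: probability_setT.
transitivity (\int[distribution P QZ]_x g x)%E.
  by rewrite ge0_integral_distribution.
rewrite (ge0_integral_density f0 mf nuE)//.
rewrite fubini_tonelli1; last 2 first.
- exact: emeasurable_funM.
- by move=> x; rewrite mule_ge0 ?lee_fin.
rewrite ge0_integral_distribution//.
- apply: measurable_fun_fubini_tonelli_F.
  + exact: emeasurable_funM.
  + by move=> x; rewrite mule_ge0 ?lee_fin.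
- by move=> x; apply: integral_ge0 => y _; rewrite mule_ge0 ?lee_fin.
Qed.

(** * Midpoint gaps of convex functions *)

Lemma convex_function_le (R : realType) (f : R -> R) :
  @convex_function R R^o setT f ->
  forall t x y : R, 0 <= t <= 1 ->
    f (t * x + (1 - t) * y) <= t * f x + (1 - t) * f y.
Proof.
move=> cf t x y /andP[t0 t1].
have := cf (Itv01 t0 t1) x y.
by rewrite !inE => /(_ I I); rewrite !convRE/=.
Qed.

Lemma div_itv01 (R : realFieldType) (x y : R) :
  (0 <= x <= y) || (y <= x <= 0) -> 0 <= x / y <= 1.
Proof.
case: (ltrgt0P y) => [y0|y0|->]; last by rewrite invr0 mulr0 lexx ler01.
- rewrite ler_pdivlMr// ler_pdivrMr//; lra.
- rewrite ler_ndivlMr// ler_ndivrMr//; lra.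
Qed.

(* With [p = (u + v) / 2], both [v] and [(u + w) / 2] are convex combinations
   of [p] and [w]; in [f v + 2 f ((u + w) / 2)] the weights sum up to 2 for [p]
   and 1 for [w]. *)
Lemma midpoint_gap_mono (R : realType) (f : R -> R) (u v w : R) :
  @convex_function R R^o setT f -> (u <= v <= w) || (w <= v <= u) ->
  (f u + f v) / 2 - f ((u + v) / 2) <= (f u + f w) / 2 - f ((u + w) / 2).
Proof.
move=> cf uvw.
(* [D] is [2 * (w - p)] for the midpoint [p] below, negative when the three points decrease. As [v]
   lies between [u] and [w], [D = 0] forces [v = w]. *)
pose D := 2 * w - u - v.
have [D0|D0] := eqVneq D 0.
  have -> : v = w by apply/le_anti; move: D0 uvw; rewrite /D; lra.
  by [].
pose s := (v - u) / D; pose t := (w - v) / D.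
pose p := (u + v) / 2.
have s01 : 0 <= s <= 1 by apply: div_itv01; rewrite /D; lra.
have t01 : 0 <= t <= 1 by apply: div_itv01; rewrite /D; lra.
have st : s = 1 - 2 * t by rewrite /s /t /D; field.
have vE : v = s * w + (1 - s) * p by rewrite /s /p /D; field.
have qE : (u + w) / 2 = t * w + (1 - t) * p by rewrite /t /p /D; field.
have := convex_function_le cf w p s01.
have := convex_function_le cf w p t01.
by rewrite -vE -qE st -/p; lra.
Qed.

(** Subtracting [m / 2 * z ^+ 2] from [psi] leaves a function convex between [x] and [y], whose
    midpoint gap is nonnegative; the gap of the subtracted quadratic is exactly
    [m / 8 * (x - y) ^+ 2]. *)
Lemma strongly_convex_midpoint_gap (R : realType) (psi : R -> R) (m b x y : R) :
  (forall z, derivable psi z 1) -> (forall z, derivable (derive1 psi) z 1) ->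
  strongly_convex_on m b psi -> - b <= x <= b -> - b <= y <= b ->
  m / 8 * (x - y) ^+ 2 <= (psi x + psi y) / 2 - psi ((x + y) / 2).
Proof.
move=> d1 d2 sc.
wlog xy : x y / x <= y.
  move=> H xb yb; have [xy|/ltW yx] := leP x y; first exact: H.
  by have := H _ _ yx yb xb; rewrite -(opprB x y) sqrrN (addrC y) (addrC (psi y)).
move=> xb yb.
pose f z := psi z - m / 2 * z ^+ 2.
have df (z : R) : is_derive z (1 : R) f (derive1 psi z - m * z).
  have := derivableP (d1 z); rewrite -derive1E => ?.
  by rewrite /f; apply: is_derive_eq; rewrite /GRing.scale/=; field.
have df1 : 'D_1 f = (fun z => derive1 psi z - m * z).
  by apply/funext => z; apply: derive_val.
have ddf (z : R) : is_derive z (1 : R) ('D_1 f) (derive1n 2 psi z - m).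
  rewrite df1.
  have := derivableP (d2 z); rewrite -derive1E => ?.
  by apply: is_derive_eq; rewrite /GRing.scale/= mulr1.
have cf : continuous f.
  by move=> z; apply: differentiable_continuous; apply/derivable1_diffP.
have half : (0 <= 1 / 2 :> R) /\ (1 / 2 <= 1 :> R) by lra.
have : f ((x + y) / 2) <= (f x + f y) / 2.
  have := @second_derivative_convex R f x y _ _ _ _ _ (Itv01 half.1 half.2) xy.
  rewrite !convRE /= /unstable.onem => fxy.
  rewrite (_ : (x + y) / 2 = 1 / 2 * x + (1 - 1 / 2) * y); last by field.
  rewrite (_ : (f x + f y) / 2 = 1 / 2 * f x + (1 - 1 / 2) * f y); last by field.
  apply: fxy.
  - move=> z xzy; rewrite (@derive_val _ _ _ _ _ _ _ (ddf z)) subr_ge0.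
    by apply: sc; rewrite in_itv/=; lra.
  - exact/cvg_at_left_filter/cf.
  - exact/cvg_at_right_filter/cf.
  - by move=> z _.
  - by move=> z _.
rewrite /f; lra.
Qed.

Lemma trunc_itv (R : realType) (b z : R) : 0 <= b -> - b <= trunc b z <= b.
Proof.
by move=> b0; rewrite /trunc le_max lexx orbT ge_max ge_min lexx orbT/=; lra.
Qed.

(** Since [x] is in [-b, b], [trunc b z] lies between [x] and [z]. Strong convexity bounds the gap
    at the truncated point, and moving that point out to [z] can only enlarge the gap. *)
Lemma truncated_midpoint_gap (R : realType) (psi : R -> R) (m b x z : R) :
  @convex_function R R^o setT psi ->
  (forall z, derivable psi z 1) -> (forall z, derivable (derive1 psi) z 1) ->
  strongly_convex_on m b psi -> - b <= x <= b ->
  m / 8 * (x - trunc b z) ^+ 2 <= (psi x + psi z) / 2 - psi ((x + z) / 2).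
Proof.
move=> cpsi d1 d2 sc xb.
have b0 : 0 <= b by lra.
have gap := strongly_convex_midpoint_gap d1 d2 sc xb (trunc_itv z b0).
apply: (le_trans gap); apply: midpoint_gap_mono => //.
rewrite /trunc /Num.max /Num.min.
by case: (ltP z b) => zb; case: ifP => // /idP; lra.
Qed.

(** * Sub-sigma-algebras and Ville's maximal inequality *)

Lemma measurable_wrtP d d' (T : measurableType d) (U : measurableType d')
    (K : set_system T) (f : T -> U) :
  measurable_wrt <<s K >> f <->
  measurable_fun setT (f : g_sigma_algebraType K -> U).
Proof.
split=> [Kf _ B mB|Kf _ [B mB <-]]; last exact: Kf.
by apply: Kf; exists B.
Qed.

Lemma measurable_wrt_sub d d' (T : measurableType d) (U : measurableType d')
    (F G : set_system T) (f : T -> U) :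
  F `<=` G -> measurable_wrt F f -> measurable_wrt G f.
Proof. by move=> FG Ff A /Ff/FG. Qed.

Lemma measurable_wrt_measurable_fun d d' (T : measurableType d)
    (U : measurableType d') (G : set_system T) (f : T -> U) :
  G `<=` measurable -> measurable_wrt G f -> measurable_fun setT f.
Proof. by move=> Gm Gf _ B mB; apply/Gm/Gf; exists B. Qed.

(** Partial products of [W 1], [W 2], ..., frozen from the first index at which they exceed [c].
    Whether factor [k.+1] is used depends on the first [k] factors only, which keeps the stopping
    rule predictable. *)
Fixpoint stopped_prod (T : Type) (R : realType) (W : nat -> T -> R) (c : R)
    (n : nat) (w : T) : R :=
  if n is k.+1 then
    stopped_prod W c k w *
      (if stopped_prod W c k w <= c then W k.+1 w else 1)
  else 1.

Lemma stopped_prod_ge0 (T : Type) (R : realType) (W : nat -> T -> R) (c : R) n w :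
  (forall n w, 0 <= W n w) -> 0 <= stopped_prod W c n w.
Proof.
move=> W0; elim: n => [|n IH] //=.
by rewrite mulr_ge0//; case: ifP.
Qed.

(** Freezing happens only above [c], so a value at most [c] shows that no factor has been
    skipped. *)
Lemma stopped_prod_le (T : Type) (R : realType) (W : nat -> T -> R) (c : R) n w :
  stopped_prod W c n w <= c ->
  stopped_prod W c n w = \prod_(1 <= t < n.+1) W t w.
Proof.
elim: n => [|n IH]/=; first by rewrite big_geq.
rewrite big_nat_recr//=; case: ifPn => [/IH -> //|/negP Vc].
by rewrite mulr1 => /Vc.
Qed.

Lemma stopped_prod_gt_mono (T : Type) (R : realType) (W : nat -> T -> R) (c : R) w :
  {homo (fun n => c < stopped_prod W c n w) : m n / (m <= n)%N >-> m ==> n}.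
Proof.
apply: homo_leq => [b|a b e|n]; [exact: implybb|by case: a b e => [] [] []|].
by apply/implyP => /= Vc; rewrite leNgt Vc mulr1.
Qed.

(** The two products agree up to the first crossing of [c], so both cross or neither does; [1 <= c]
    keeps the empty product at index 0 from crossing. *)
Lemma stopped_prod_gtP (T : Type) (R : realType) (W : nat -> T -> R) (c : R) w :
  1 <= c ->
  (exists n, (1 <= n)%N /\ c < \prod_(1 <= t < n.+1) W t w) <->
  (exists n, c < stopped_prod W c n w).
Proof.
move=> c1; split=> [[n [_ cS]]|[n]].
  exists n; rewrite ltNge; apply/negP => Vc.
  by move: cS; rewrite -(stopped_prod_le Vc) ltNge Vc.
elim: n => [/= |n IH cV]; first by rewrite ltNge c1.
have [Vc|/IH//] := leP (stopped_prod W c n w) c.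
exists n.+1; split=> //; rewrite big_nat_recr//= -(stopped_prod_le Vc).
by move: cV; rewrite /= Vc.
Qed.

(* Ville's maximal inequality: the product is stopped when it first exceeds
   [c]; the stopped product still has expectation at most 1, and its super-level
   sets are nondecreasing. *)
Lemma ville_prod d (T : measurableType d) (R : realType) (P : probability T R)
    (K : nat -> set_system T) (W : nat -> T -> R) (c : R) :
  (forall n, <<s K n >> `<=` measurable) ->
  (forall n, <<s K n >> `<=` <<s K n.+1 >>) ->
  (forall n w, 0 <= W n w) ->
  (forall n, measurable_wrt <<s K n.+1 >> (W n.+1)) ->
  (forall n (U : T -> R), (forall w, 0 <= U w) -> measurable_wrt <<s K n >> U ->
    (\int[P]_w (U w * W n.+1 w)%R%:E <= \int[P]_w (U w)%:E)%E) ->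
  1 <= c ->
  (P [set w | exists n, (1 <= n)%N /\ (c < \prod_(1 <= t < n.+1) W t w)%R]
   <= (c^-1)%:E)%E.
Proof.
move=> Km Kn W0 mW EW c1.
have c0 : 0 < c by exact: lt_le_trans c1.
pose V := stopped_prod W c.
have V0 n w : 0 <= V n w by exact: stopped_prod_ge0.
have mVK n : measurable_wrt <<s K n >> (V n).
  elim: n => [|n IH]; first exact/measurable_wrtP/measurable_cst.
  apply/measurable_wrtP; apply: measurable_funM.
    by apply/measurable_wrtP; apply: measurable_wrt_sub IH; exact: Kn.
  apply: measurable_fun_ifT; last exact: measurable_cst.
    apply: measurable_fun_ler; last exact: measurable_cst.
    by apply/measurable_wrtP; apply: measurable_wrt_sub IH; exact: Kn.
  exact/measurable_wrtP.
have mV n : measurable_fun setT (V n) by exact: measurable_wrt_measurable_fun (mVK n).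
have mW' n : measurable_fun setT (W n.+1).
  exact: measurable_wrt_measurable_fun (mW n).
have EV n : (\int[P]_w (V n w)%:E <= 1)%E.
  elim: n => [|n IH].
    have /= := integral_cst P measurableT 1%E.
    by rewrite (probability_setT P) mule1 => int1; rewrite -[leRHS]int1.
  apply: le_trans IH.
  pose U w := V n w * (if V n w <= c then 1 else 0).
  pose U' w := V n w * (if V n w <= c then 0 else 1).
  have U0 w : 0 <= U w by rewrite mulr_ge0//; case: ifP.
  have U'0 w : 0 <= U' w by rewrite mulr_ge0//; case: ifP.
  have mU : measurable_wrt <<s K n >> U.
    apply/measurable_wrtP; apply: measurable_funM; first exact/measurable_wrtP.
    apply: measurable_fun_ifT; try exact: measurable_cst.
    by apply: measurable_fun_ler; [exact/measurable_wrtP|exact: measurable_cst].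
  have mUT : measurable_fun setT U by exact: measurable_wrt_measurable_fun mU.
  have mU'T : measurable_fun setT U'.
    apply: measurable_funM => //; apply: measurable_fun_ifT => //.
    exact: measurable_fun_ler.
  have VE w : (V n.+1 w)%:E = ((U w * W n.+1 w)%R%:E + (U' w)%:E)%E.
    rewrite -EFinD; congr (_%:E); rewrite /U /U' /V /=.
    by case: ifP => _; rewrite ?mulr0 ?mul0r ?mulr1 ?addr0 ?add0r.
  under eq_integral do rewrite VE.
  rewrite ge0_integralD//; first last.
  - exact/measurable_EFinP.
  - by move=> w _; rewrite lee_fin.
  - by apply/measurable_EFinP; exact: measurable_funM.
  - by move=> w _; rewrite lee_fin mulr_ge0.
  apply: (@le_trans _ _ (\int[P]_w (U w)%:E + \int[P]_w (U' w)%:E)%E).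
    by rewrite leeD2r// EW.
  rewrite -ge0_integralD//; first last.
  - exact/measurable_EFinP.
  - by move=> w _; rewrite lee_fin.
  - exact/measurable_EFinP.
  - by move=> w _; rewrite lee_fin.
  rewrite le_eqVlt; apply/orP; left; apply/eqP; apply: eq_integral => w _.
  by rewrite -EFinD /U /U'; case: ifP; rewrite ?mulr0 ?mulr1 ?addr0 ?add0r.
rewrite [X in P X](_ : _ = \bigcup_n [set w | c < V n w]); last first.
  apply/seteqP; split=> w /=.
    by move=> /(stopped_prod_gtP _ _ c1)[n cV]; exists n.
  by move=> [n _ cV]; apply/stopped_prod_gtP => //; exists n.
have mE n : measurable [set w | c < V n w].
  rewrite (_ : [set _ | _] = setT `&` V n @^-1` `]c, +oo[); first exact: mV.
  by apply/seteqP; split=> w; rewrite /= in_itv/= andbT // => -[].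
have mUE : measurable (\bigcup_n [set w | c < V n w]) by exact: bigcup_measurable.
(* Frozen values stay above [c], so the crossing events increase and continuity from below reduces
   the claim to a bound for each single [n]. *)
have nd : nondecreasing_seq (fun n => [set w | c < V n w]).
  move=> a b ab; apply/subsetPset => w /=.
  by apply/implyP; exact: stopped_prod_gt_mono.
have cvgP := @nondecreasing_cvg_mu _ _ _ P _ mE mUE nd.
rewrite -(cvg_lim _ cvgP)//.
apply: lime_le; first by apply/cvg_ex; eexists; exact: cvgP.
apply: nearW => n /=.
(* Markov's inequality for [V n] at level [c]. *)
rewrite -(@lee_pmul2l _ c%:E)// -EFinM divff ?gt_eqF//.
apply: le_trans (EV n).
have mVE : measurable_fun setT (EFin \o V n) by exact/measurable_EFinP.
have := le_integral_abse P measurableT mVE c0.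
rewrite setTI => /(le_trans _) Vc.
apply: (le_trans (Vc _ _)).
  rewrite lee_pmul2l//; apply: le_measure; rewrite ?inE//.
    rewrite -[X in measurable X]setTI; apply: emeasurable_fun_c_infty => //.
    exact: measurableT_comp.
  by move=> w /= /ltW cV; rewrite lee_fin ger0_norm.
apply: ge0_le_integral => //.
- exact: measurableT_comp.
- by move=> w _; rewrite /= lee_fin ger0_norm.
Qed.

(** * Exponential families under conditioning *)

Lemma ge0_integral_in_density d (T : measurableType d) (R : realType)
    (mu nu : {measure set T -> \bar R}) (f : T -> R) (g : T -> \bar R) (B : set T) :
    measurable B ->
    (forall x, (0 <= f x)%R) -> measurable_fun setT f ->
    (forall A, measurable A -> nu A = (\int[mu]_(x in A) (f x)%:E)%E) ->
    (forall x, (0 <= g x)%E) -> measurable_fun setT g ->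
  (\int[nu]_(x in B) g x = \int[mu]_(x in B) (g x * (f x)%:E))%E.
Proof.
move=> mB f0 mf nuE g0 mg.
rewrite integral_mkcond (ge0_integral_density f0 mf nuE)//.
- rewrite [RHS]integral_mkcond; apply: eq_integral => x _; rewrite !patchE.
  by case: ifPn => //; rewrite mul0e.
- by move=> x; apply: erestrict_ge0.
- by apply/(measurable_restrictT _ _).1 => //; exact: measurable_funTS.
Qed.

(** Exponential tilting: multiplying the density with natural parameter [zeta] by [expR (c * y)]
    gives, up to the factor [expR (psi (zeta + c) - psi zeta)], the density with parameter
    [zeta + c], which integrates to 1. *)
Lemma exp_family_mgf (R : realType) (L : set R) (mu : {measure set R -> \bar R})
    (h psi : R -> R) (d : measure_display) (T : measurableType d)
    (P : probability T R) (K : set_system T) (Z : T -> R) (zeta U a c : T -> R) :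
  measurable L -> measurable_fun setT psi ->
  (forall z, is_density mu L (fun y => expR (z * y - psi z) * h y)) ->
  <<s K >> `<=` measurable -> measurable_fun setT Z -> (forall w, L (Z w)) ->
  measurable_wrt <<s K >> zeta ->
  is_cond_density P mu L <<s K >> Z
    (fun w y => expR (zeta w * y - psi (zeta w)) * h y) ->
  (forall w, 0 <= U w) -> measurable_wrt <<s K >> U ->
  measurable_wrt <<s K >> a -> measurable_wrt <<s K >> c ->
  (\int[P]_w (U w * expR (a w + c w * Z w))%:E =
   \int[P]_w (U w * expR (a w + psi (zeta w + c w) - psi (zeta w)))%:E)%E.
Proof.
move=> mL mpsi dens Km mZ ZL /measurable_wrtP mzeta cd U0 /measurable_wrtP mU
  /measurable_wrtP ma /measurable_wrtP mc.
pose E := g_sigma_algebraType K.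
(* Conditioning on the sigma-algebra becomes conditioning on a random element: the identity into [T]
   equipped with that sigma-algebra. *)
have mid : measurable_fun setT (idfun : T -> E).
  by move=> _ B mB; rewrite setTI; exact: Km.
pose Q : {mfun T >-> E} := HB.pack (idfun : T -> E) (isMeasurableFun.Build _ _ _ _ _ mid).
pose Z' : {mfun T >-> R} := HB.pack Z (isMeasurableFun.Build _ _ _ _ _ mZ).
(* The family member with parameter 0, extended by 0 outside [L], yields a reference probability
   [kap]. Relative to it, the member with parameter [zeta] has the density [f] below, free of [h]
   and jointly measurable. *)
pose p0 : R -> R := (fun y => expR (0 * y - psi 0) * h y) \_ L.
have [mp p_ge0 intp] := dens 0.
have p00 y : 0 <= p0 y.
  by rewrite /p0 patchE; case: ifPn => // /set_mem; exact: p_ge0.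
have mp0 : measurable_fun setT p0 by apply/(measurable_restrictT _ _).1.
have kT : mdensity mu p00 mp0 setT = 1%E.
  rewrite -intp /mdensity [RHS]integral_mkcond; apply: eq_integral => y _.
  by rewrite /p0 !patchE; case: ifP.
pose kap : probability R R :=
  HB.pack (mdensity mu p00 mp0) (Measure_isProbability.Build _ _ _ _ kT).
have kapE B (e : R -> R) : measurable B -> (forall y, 0 <= e y) ->
    measurable_fun setT e ->
    (\int[kap]_(y in B) (e y)%:E =
     \int[mu]_(y in B `&` L) (e y * (expR (- psi 0) * h y))%:E)%E.
  move=> mB e0 me.
  rewrite (@ge0_integral_in_density _ _ _ mu kap p0)//; last first.
    exact/measurable_EFinP.
  rewrite integral_mkcondr; apply: eq_integral => y _.
  rewrite -EFinM /p0 !patchE; case: ifP => _; last by rewrite mulr0.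
  by rewrite mul0r add0r.
pose f (x : E * R) := expR (zeta x.1 * x.2 - psi (zeta x.1) + psi 0).
have mzeta1 : measurable_fun setT (fun x : E * R => zeta x.1).
  exact: measurableT_comp mzeta measurable_fst.
have mf : measurable_fun setT f.
  apply: measurableT_comp => //; apply: measurable_funD => //.
  apply: measurable_funB; last exact: measurableT_comp.
  by apply: measurable_funM => //; exact: measurable_snd.
have f0 x : 0 <= f x by exact: expR_ge0.
have PE (A : set E) (B : set R) : measurable A -> measurable B ->
    (P (Q @^-1` A `&` Z' @^-1` B) =
    \int[P]_(w in Q @^-1` A) \int[kap]_(y in B) (f (Q w, y))%:E)%E.
  move=> mA mB.
  (* As [Z] takes values in [L], the set [B] may be cut down to [L], where the conditional density
     is available. *)
  rewrite (_ : _ `&` _ = A `&` Z @^-1` (B `&` L)); last first.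
    apply/seteqP; split=> w /=; first by move=> [Aw Bw]; split=> //; split.
    by move=> [Aw [Bw _]].
  have [_ ->//] := cd (B `&` L) (measurableI _ _ mB mL) (@subIsetr _ _ _).
  apply: eq_integral => w _.
  rewrite kapE//; last first.
    exact: measurableT_comp mf (pair1_measurable (w : E)).
  apply: eq_integral => y _; rewrite /f /= mulrA -expRD.
  by rewrite addrK.
pose g (x : E * R) := (U x.1 * expR (a x.1 + c x.1 * x.2))%:E.
have mg : measurable_fun setT g.
  apply/measurable_EFinP; apply: measurable_funM.
    exact: measurableT_comp mU measurable_fst.
  apply: measurableT_comp => //; apply: measurable_funD.
    exact: measurableT_comp ma measurable_fst.
  apply: measurable_funM; last exact: measurable_snd.
  exact: measurableT_comp mc measurable_fst.
have g0 x : (0 <= g x)%E by rewrite lee_fin mulr_ge0 ?expR_ge0.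
rewrite [LHS](ge0_integral_cond_density f0 mf PE g0 mg).
apply: eq_integral => w _.
rewrite /g /f /=.
under eq_integral do rewrite -EFinM.
rewrite kapE//; first last.
- apply: measurable_funM.
    apply: measurable_funM => //; apply: measurableT_comp => //.
    by apply: measurable_funD => //; exact: measurable_funM.
  exact: measurableT_comp mf (pair1_measurable (w : E)).
- by move=> y; rewrite !mulr_ge0 ?expR_ge0.
(* The tilted member, whose total mass 1 is inserted on the right-hand side. *)
have [mq q_ge0 intq] := dens (zeta w + c w).
rewrite setTI -[RHS]mule1 -intq -ge0_integralZl//.
- apply: eq_integral => y _; rewrite -EFinM; congr (_%:E).
  rewrite !mulrA; congr (_ * h y); rewrite -!mulrA -!expRD.
  by congr (_ * expR _); ring.
- exact/measurable_EFinP.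
- by rewrite lee_fin mulr_ge0 ?expR_ge0.
Qed.

(** * Inner products, truncation and the history filtration *)

Lemma inner_surj (R : realType) (d : nat) (z : R) : (1 <= d)%N ->
  exists u v : d.-tuple R, inner u v = z.
Proof.
case: d => // d _.
exists [tuple (if i == ord0 then z else 0) | i < d.+1], [tuple 1 | _ < d.+1].
rewrite /inner big_ord_recl !tnth_mktuple eqxx mulr1 big1 ?addr0// => i _.
by rewrite !tnth_mktuple mul0r.
Qed.

Lemma measurable_inner d (T : measurableType d) (R : realType) (k : nat)
    (f g : T -> k.-tuple R) :
  measurable_fun setT f -> measurable_fun setT g ->
  measurable_fun setT (fun w => inner (f w) (g w)).
Proof.
move=> mf mg; apply: measurable_sum => i; apply: measurable_funM.
  exact: measurableT_comp (measurable_tnth i) mf.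
exact: measurableT_comp (measurable_tnth i) mg.
Qed.

Lemma measurable_trunc (R : realType) (b : R) : measurable_fun setT (trunc b).
Proof.
by apply: measurable_maxr; [apply: measurable_minr|].
Qed.

Section history.
Context d (T : measurableType d) (R : realType) (k : nat)
  (X : nat -> T -> k.-tuple R) (Y : nat -> T -> R).

Lemma history_measurable t :
  (forall s, (1 <= s)%N -> measurable_fun setT (X s)) ->
  (forall s, (1 <= s)%N -> measurable_fun setT (Y s)) ->
  history X Y t `<=` measurable.
Proof.
move=> mX mY; apply: smallest_sub; first exact: sigma_algebra_measurable.
by move=> A [[s /= /andP[s1 _] [B mB <-]]|[s /= /andP[s1 _] [B mB <-]]];
  [exact: mX|exact: mY].
Qed.

Lemma history_nondecreasing t : history X Y t `<=` history X Y t.+1.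
Proof.
apply: sub_sigma_algebra2 => A [[s /= /andP[s1 st] XA]|[s /= /andP[s1 st] YA]].
  by left; exists s => //=; rewrite s1 leqW.
by right; exists s => //=; rewrite s1 leqW.
Qed.

Lemma history_X t s : (1 <= s <= t.+1)%N -> measurable_wrt (history X Y t) (X s).
Proof. by move=> st A XA; apply: sub_sigma_algebra; left; exists s. Qed.

Lemma history_Y t s : (1 <= s <= t)%N -> measurable_wrt (history X Y t) (Y s).
Proof. by move=> st A YA; apply: sub_sigma_algebra; right; exists s. Qed.

End history.

(** * The supermartingale behind the confidence sets *)

Theorem theorem4p4 (R : realType) (d : nat) (d_ge1 : (1 <= d)%N)
    (* label space and reference measure *)
    (L : set R) (mL : measurable L)
    (mu : {measure set R -> \bar R}) (mu_sfinite : sigma_finite L mu)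
    (* model *)
    (h : R -> R) (h_ge0 : forall y, L y -> 0 <= h y)
    (psi : R -> R)
    (psi_convex : @convex_function R R^o setT psi)
    (psi_diff : forall z, derivable psi z 1)
    (p_density : forall x theta : d.-tuple R,
       is_density mu L (glm_density psi h x theta))
    (M : R) (M_gt0 : 0 < M) (psi_smooth : smooth M psi)
    (* data *)
    (disp : measure_display) (T : measurableType disp) (P : probability T R)
    (X : nat -> T -> d.-tuple R) (Y : nat -> T -> R)
    (mX : forall t, (1 <= t)%N -> measurable_fun setT (X t))
    (mY : forall t, (1 <= t)%N -> measurable_fun setT (Y t))
    (Y_in_L : forall t w, (1 <= t)%N -> L (Y t w))
    (thetastar : d.-tuple R)
    (Y_cond_density : forall t, (1 <= t)%N ->
       is_cond_density P mu L (history X Y t.-1) (Y t)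
         (fun w => glm_density psi h (X t w) thetastar))
    (* hypotheses of the theorem *)
    (b : R) (b_gt0 : 0 < b)
    (X_bounded : forall t w, (1 <= t)%N -> `|inner thetastar (X t w)| <= b)
    (m : R) (m_gt0 : 0 < m) (psi_strong : strongly_convex_on m b psi)
    (theta : nat -> T -> d.-tuple R)
    (theta_predictable : forall t, (1 <= t)%N ->
       measurable_wrt (history X Y t.-1) (theta t))
    (delta : R) (delta_gt0 : 0 < delta) (delta_lt1 : delta < 1) :
  (P [set w | exists n : nat, (1 <= n)%N /\
        ~ confidence_set psi h X Y theta thetastar b m delta n w thetastar]
   <= delta%:E)%E.
Proof.
have mpsi : measurable_fun setT psi.
  apply: continuous_measurable_fun => z.
  by apply: differentiable_continuous; apply/derivable1_diffP.
have [_ psi_diff2 _] := psi_smooth.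
have dens z : is_density mu L (fun y => expR (z * y - psi z) * h y).
  (* As [d] is at least 1, every real [z] occurs as an inner product, so the model provides a
     density for every natural parameter. *)
  have [u [v <-]] := inner_surj z d_ge1; exact: p_density v u.
pose zs t w := inner thetastar (X t w).
pose zt t w := inner (theta t w) (X t w).
(* The exponent of the factor [W t] is affine in the label [Y t], with predictable coefficients
   [a t] and [c t]; [c t] is half the parameter shift, as the likelihood ratio enters through its
   square root. *)
pose a t w := m / 8 * (zs t w - Yhat X theta b t w) ^+ 2 + (psi (zs t w) - psi (zt t w)) / 2.
pose c t w := (zt t w - zs t w) / 2.
pose W t w := expR (a t w + c t w * Y t w).
(* Generators of [history X Y t]. They include [X t.+1], so [a t.+1] and [c t.+1] are measurable at
   time [t] while [Y t.+1] is not yet observed. *)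
pose K t : set_system T := (\bigcup_(s in [set s | (1 <= s <= t.+1)%N])
         g_sigma_algebra_preimage (X s)) `|`
      (\bigcup_(s in [set s | (1 <= s <= t)%N])
         g_sigma_algebra_preimage (Y s)).
have Km t : <<s K t>> `<=` measurable by exact: history_measurable.
have mXK t : measurable_fun setT (X t.+1 : g_sigma_algebraType (K t) -> _).
  by apply/measurable_wrtP; apply: history_X; rewrite leqnn.
have mzs t : measurable_fun setT (zs t.+1 : g_sigma_algebraType (K t) -> R).
  by apply: measurable_inner => //; exact: measurable_cst.
have mzt t : measurable_fun setT (zt t.+1 : g_sigma_algebraType (K t) -> R).
  apply: measurable_inner => //; apply/measurable_wrtP.
  exact: (theta_predictable t.+1).
have ma t : measurable_fun setT (a t.+1 : g_sigma_algebraType (K t) -> R).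
  apply: measurable_funD.
    apply: measurable_funM => //; apply: measurable_funX.
    apply: measurable_funB => //.
    exact: measurableT_comp (measurable_trunc b) (mzt t).
  by apply: measurable_funM => //; apply: measurable_funB; apply: measurableT_comp.
have mc t : measurable_fun setT (c t.+1 : g_sigma_algebraType (K t) -> R).
  by apply: measurable_funM => //; exact: measurable_funB.
(* This is the exponent left after integrating out [Y t.+1]. Shifting [zs] by [c] lands on the
   midpoint of [zs] and [zt], so the exponent is the quadratic term minus the midpoint gap. *)
have gap t w : a t.+1 w + psi (zs t.+1 w + c t.+1 w) - psi (zs t.+1 w) <= 0.
  have xb : - b <= zs t.+1 w <= b by rewrite -ler_norml X_bounded.
  have := truncated_midpoint_gap (zt t.+1 w) psi_convex psi_diff psi_diff2 psi_strong xb.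
  rewrite (_ : zs t.+1 w + c t.+1 w = (zs t.+1 w + zt t.+1 w) / 2); last first.
    by rewrite /c; field.
  by rewrite /a /Yhat -/(zt _ _); lra.
have step t (U : T -> R) : (forall w, 0 <= U w) -> measurable_wrt <<s K t>> U ->
    (\int[P]_w (U w * W t.+1 w)%R%:E <= \int[P]_w (U w)%:E)%E.
  move=> U0 mU.
  have mUT := measurable_wrt_measurable_fun (Km t) mU.
  have mG := measurable_wrt_measurable_fun (Km t).
  have /measurable_wrtP/mG mgapT : measurable_fun setT
      ((fun w => U w * expR (a t.+1 w + psi (zs t.+1 w + c t.+1 w) - psi (zs t.+1 w)))
        : g_sigma_algebraType (K t) -> R).
    apply: measurable_funM; first exact/measurable_wrtP.
    apply: measurableT_comp => //; apply: measurable_funB; last exact: measurableT_comp.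
    apply: measurable_funD => //; apply: measurableT_comp => //.
    exact: measurable_funD.
  rewrite (exp_family_mgf mL mpsi dens (Km t) (mY t.+1 isT)
    (fun w => @Y_in_L t.+1 w isT) ((measurable_wrtP _ _).2 (mzs t))
    (Y_cond_density t.+1 isT) U0 mU ((measurable_wrtP _ _).2 (ma t))
    ((measurable_wrtP _ _).2 (mc t))).
  apply: ge0_le_integral => //.
  - by move=> w _; rewrite lee_fin mulr_ge0 ?expR_ge0.
  - exact/measurable_EFinP.
  - exact/measurable_EFinP.
  - by move=> w _; rewrite lee_fin ler_piMr// -expR0 ler_expR.
have Wprod n w : \prod_(1 <= t < n.+1) W t w =
    expR (m / 8 * \sum_(1 <= t < n.+1) (zs t w - Yhat X theta b t w) ^+ 2
          - regret psi h X Y theta n thetastar w / 2).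
  rewrite -expR_sum; congr expR.
  rewrite mulr_sumr /regret mulr_suml -sumrB; apply: eq_bigr => t _.
  by rewrite /a /c /loss -/(zs _ _) -/(zt _ _); field.
have d1 : 1 <= 1 / delta by rewrite ler_pdivlMr// mul1r ltW.
have -> : [set w | exists n, (1 <= n)%N /\
    ~ confidence_set psi h X Y theta thetastar b m delta n w thetastar] =
  [set w | exists n, (1 <= n)%N /\ 1 / delta < \prod_(1 <= t < n.+1) W t w].
  suff conf n w : ~ confidence_set psi h X Y theta thetastar b m delta n w thetastar <->
      1 / delta < \prod_(1 <= t < n.+1) W t w.
    by apply/seteqP; split=> w [n [n1 /conf ?]]; exists n.
  have dE : 1 / delta = expR (ln (1 / delta)) by rewrite lnK// posrE divr_gt0.
  rewrite Wprod [X in X < _]dE ltr_expR /confidence_set /= /beta -/(zs _ _).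
  (* Scaling by [m / 4] turns the coefficients of [beta] into 1/2 and 1, and the factor 1/2 of the
     sum into [m / 8], which matches the exponent in [Wprod]. *)
  rewrite (rwP negP) -ltNge -(ltr_pM2l (_ : 0 < m / 4)); last by rewrite divr_gt0.
  set S := \sum_(_ <= _ < _) _; set r := regret _ _ _ _ _ _ _ _.
  rewrite (_ : m / 4 * (1 / 2 * S) = m / 8 * S); last by field.
  rewrite mulrDr !mulrA.
  rewrite (_ : m / 4 * 2 / m * r = r / 2); last by field; rewrite gt_eqF.
  rewrite (_ : m / 4 * 4 / m = 1); last by field; rewrite gt_eqF.
  by rewrite !mul1r ltrBrDr addrC.
rewrite [leRHS](_ : _ = ((1 / delta)^-1)%:E); last by rewrite div1r invrK.
apply: (@ville_prod _ T R P K) => //.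
- by move=> t; exact: history_nondecreasing.
- by move=> t w; exact: expR_ge0.
- move=> t; apply/measurable_wrtP; apply: measurableT_comp => //.
  (* The coefficients are lifted from time [t] to [t.+1], the first time at which [Y t.+1] is
     measurable. *)
  have Kt : <<s K t>> `<=` <<s K t.+1>> by exact: history_nondecreasing.
  have up (f : T -> R) : measurable_fun setT (f : g_sigma_algebraType (K t) -> R) ->
      measurable_fun setT (f : g_sigma_algebraType (K t.+1) -> R).
    by move=> /measurable_wrtP/(measurable_wrt_sub Kt)/measurable_wrtP.
  apply: measurable_funD; first exact: up.
  apply: measurable_funM; first exact: up.
  by apply/measurable_wrtP; apply: history_Y; rewrite leqnn.
Qed.
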